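(* Let $\rho\in M_n^+$ be a mixed quantum state and let $P$ be the orthogonal projection onto $\mathrm{range}(\rho)$. Then $D_{\mathrm{coh}}(\rho)=1$ if and only if $P_{j,j}\le 1/2$ for all $1\le j\le n$.
   Context: $M_n^+$ is the set of $n\times n$ complex (Hermitian) positive semidefinite matrices. A mixed quantum state is a positive semidefinite matrix of trace $1$. The trace norm $\|A\|_{\mathrm{tr}}$ is the sum of the singular values of $A$. Let $C_{\mathrm{coh}}\subseteq M_n^+$ be the cone of all diagonal positive semidefinite matrices (not necessarily of trace $1$). The modified trace distance of coherence is $$D_{\mathrm{coh}}(\rho)=\min\{\|\rho-X\|_{\mathrm{tr}} : X\in C_{\mathrm{coh}}\}.$$ *)

(* Defs.v *)
From mathcomp Require Import all_boot all_order all_algebra.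
From mathcomp Require Import sesquilinear spectral.
From mathcomp Require Import boolp classical_sets reals.
From mathcomp Require Import complex.

Set Implicit Arguments.
Unset Strict Implicit.
Unset Printing Implicit Defensive.

Import Order.TTheory GRing.Theory Num.Theory.
Local Open Scope classical_set_scope.
Local Open Scope ring_scope.
Local Open Scope sesquilinear_scope.
Local Open Scope complex_scope.

Section Coherence.
Context {R : realType}.

(* In the order of R[i], [0 <= z] means that z is real and nonnegative. *)
Definition psd (n : nat) (A : 'M[R[i]]_n) : Prop :=
  A \is hermsymmx /\ forall v : 'cV[R[i]]_n, 0 <= (v^t* *m A *m v) 0 0.

Definition mixed_state (n : nat) (rho : 'M[R[i]]_n) : Prop :=
  psd rho /\ \tr rho = 1.

(* [A^t* *m A] is normal, so [spectral_diag] lists its eigenvalues with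
   multiplicity; they are real and nonnegative, so that taking the real part
   only changes the type. *)
Definition singular_value (n : nat) (A : 'M[R[i]]_n) (i : 'I_n) : R :=
  Num.sqrt (complex.Re (spectral_diag (A^t* *m A) 0 i)).

Definition trace_norm (n : nat) (A : 'M[R[i]]_n) : R :=
  \sum_(i < n) singular_value A i.

Definition C_coh (n : nat) : set 'M[R[i]]_n :=
  [set X | psd X /\ is_diag_mx X].

(* The least element of S, or 0 if S has none. *)
Definition set_min (S : set R) : R := xget 0 (S `&` lbound S).

(* The minimum exists (a continuous coercive function on a closed set), so the
   default value of [set_min] is never used here. *)
Definition D_coh (n : nat) (rho : 'M[R[i]]_n) : R :=
  set_min [set trace_norm (rho - X) | X in @C_coh n].

(* MathComp's matrix spaces are row spaces; matrices act here on column
   vectors, so the range of A is the row space of [A^T]. *)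
Definition orthogonal_projection_onto_range (n : nat) (A P : 'M[R[i]]_n) :
    Prop :=
  [/\ P \is hermsymmx, P *m P = P & (P^T :=: A^T)%MS].

End Coherence.

(* Main.v *)
(* Taking X = 0 shows that the minimum is 1 exactly when no diagonal psd X
   satisfies ||rho - X|| < 1.  If all P_jj <= 1/2, pairing rho - X with the
   contraction 2P - 1 gives ||rho - X|| >= 1 - tr ((2P - 1) X) >= 1.  If some
   P_jj > 1/2, a small multiple of E_jj is strictly better than 0: the
   directional derivative of the trace norm there is 1 - 2 P_jj. *)
Require Import Defs.
From mathcomp Require Import all_boot all_order all_algebra.
From mathcomp Require Import sesquilinear spectral.
From mathcomp Require Import boolp classical_sets reals.
From mathcomp Require Import complex.
From mathcomp Require Import ring.
Import Order.TTheory GRing.Theory Num.Theory.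
Local Open Scope ring_scope.
Local Open Scope complex_scope.

(** * Uniqueness of the spectrum up to order *)

Section Spectrum.
Local Open Scope sesquilinear_scope.

Lemma char_poly_conj {F : fieldType} {n} (V A : 'M[F]_n) :
  V \in unitmx -> char_poly (invmx V *m A *m V) = char_poly A.
Proof.
move=> Vu; have VV : map_mx polyC (invmx V) *m map_mx polyC V = 1%:M.
  by rewrite -map_mxM mulVmx// map_mx1.
rewrite /char_poly /char_poly_mx 2!map_mxM.
rewrite [X in \det (X - _)](_ : _ = map_mx polyC (invmx V) *m 'X%:M
    *m map_mx polyC V); last first.
  by rewrite -mulmxA -scalar_mxC mulmxA VV mul1mx.
by rewrite -mulmxBl -mulmxBr !det_mulmx mulrAC -det_mulmx VV det1 mul1r.
Qed.

(** Both diagonals list the roots of one characteristic polynomial. [spectral_diag] comes in an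
    unspecified order, so diagonalizations can only be compared up to a permutation. *)
Lemma perm_eq_unitary_diag {C : numClosedFieldType} {n} (V W : 'M[C]_n)
    (d e : 'rV[C]_n) :
  V \is unitarymx -> W \is unitarymx ->
  V^t* *m diag_mx d *m V = W^t* *m diag_mx e *m W ->
  perm_eq [seq d 0 i | i : 'I_n] [seq e 0 i | i : 'I_n].
Proof.
move=> Vu Wu /(congr1 char_poly).
rewrite -!invmx_unitary// !char_poly_conj ?unitarymx_unit//.
rewrite !char_poly_trig ?diag_mx_is_trig// => eq_de.
apply: prod_XsubC_eq; rewrite !big_image /=; move: eq_de.
have diagE (f : 'rV[C]_n) : \prod_i ('X - (diag_mx f i i)%:P)
    = \prod_i ('X - (f 0 i)%:P).
  by apply: eq_bigr => i _; rewrite mxE eqxx mulr1n.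
by rewrite !diagE.
Qed.

Lemma hermsymmxP {C : numClosedFieldType} {n} {A : 'M[C]_n} :
  reflect (A^t* = A) (A \is hermsymmx).
Proof.
by apply: (iffP (is_hermitianmxP _ _ _)); rewrite expr0 scale1r.
Qed.

Lemma spectral_decomposition {C : numClosedFieldType} {n} (A : 'M[C]_n) :
  A \is hermsymmx ->
  A = (spectralmx A)^t* *m diag_mx (spectral_diag A) *m spectralmx A.
Proof.
move=> /hermitian_normalmx /orthomx_spectralP {1}->.
by rewrite invmx_unitary ?spectral_unitarymx.
Qed.

End Spectrum.

(** * Trace norm bounds in an eigenbasis *)

Section TraceNorm.
Context {R : realType} {n : nat}.
Local Open Scope sesquilinear_scope.
Implicit Types (A P S T Q X : 'M[R[i]]_n) (v : 'cV[R[i]]_n).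

Lemma adjD m p (A B : 'M[R[i]]_(m, p)) : (A + B)^t* = A^t* + B^t*.
Proof. by rewrite linearD map_mxD. Qed.

Lemma adjB m p (A B : 'M[R[i]]_(m, p)) : (A - B)^t* = A^t* - B^t*.
Proof. by rewrite linearB map_mxB. Qed.

Lemma adjM m p q (A : 'M[R[i]]_(m, p)) (B : 'M[R[i]]_(p, q)) :
  (A *m B)^t* = B^t* *m A^t*.
Proof. by rewrite trmx_mul map_mxM. Qed.

Lemma adjZ m p c (A : 'M[R[i]]_(m, p)) : 0 <= c -> (c *: A)^t* = c *: A^t*.
Proof. by move=> c0; rewrite linearZ map_mxZ /= conj_Creal ?ger0_real. Qed.

Lemma spectral_diag_real A i :
  A \is hermsymmx -> spectral_diag A 0 i \is Num.real.
Proof. by move=> /hermitian_spectral_diag_real /mxOverP; exact. Qed.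

(** An eigenbasis of [A] also diagonalizes [A^t* *m A], with the squared eigenvalues on the
    diagonal; the sum of their square roots does not depend on the order. *)
Lemma trace_norm_hermitian A : A \is hermsymmx ->
  (trace_norm A)%:C = \sum_i `|spectral_diag A 0 i|.
Proof.
move=> Ah; set d := spectral_diag A.
have AAh : A^t* *m A \is hermsymmx by apply/hermsymmxP; rewrite adjM trmxCK.
pose e := \row_i (d 0 i ^+ 2).
have AA : A^t* *m A = (spectralmx A)^t* *m diag_mx e *m spectralmx A.
  rewrite (hermsymmxP Ah) [in LHS](spectral_decomposition _ Ah) !mulmxA.
  rewrite mulmxtVK ?spectral_unitarymx//.
  congr (_ *m _); rewrite -mulmxA mulmx_diag.
  by congr (_ *m diag_mx _); apply/rowP => i; rewrite !mxE expr2.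
have := spectral_decomposition _ AAh; rewrite {1}AA => /esym.
move/(perm_eq_unitary_diag _ _ _ _ (spectral_unitarymx _) (spectral_unitarymx _)).
move=> ed; rewrite /trace_norm /singular_value.
have big_seq (f : 'rV[R[i]]_n) : \sum_i Num.sqrt (complex.Re (f 0 i))
    = \sum_(x <- [seq f 0 i | i : 'I_n]) Num.sqrt (complex.Re x).
  by rewrite big_image.
rewrite big_seq (perm_big _ ed) -big_seq rmorph_sum; apply: eq_bigr => i _ /=.
rewrite mxE; have /complex_realP[r ->] := spectral_diag_real _ i Ah.
by rewrite -rmorphXn /= sqrtr_sqr normc_def /= expr0n addr0 sqrtr_sqr.
Qed.

Lemma spectral_diagE A i : A \is hermsymmx ->
  spectral_diag A 0 i = (spectralmx A *m A *m (spectralmx A)^t*) i i.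
Proof.
move=> Ah; have Vu := spectral_unitarymx A.
rewrite [in X in _ *m X *m _](spectral_decomposition _ Ah) !mulmxA.
by rewrite (unitarymxP Vu) mul1mx mulmxtVK// mxE eqxx mulr1n.
Qed.

(** The entry is the quadratic form of [S] at the adjoint of row [i] of [V]. *)
Lemma psd_conj_diag_ge0 m S (V : 'M[R[i]]_(m, n)) i :
  psd S -> 0 <= (V *m S *m V^t*) i i.
Proof.
case=> _ /(_ ((row i V)^t*)); rewrite trmxCK -row_mul.
suff -> : (V *m S *m V^t*) i i = (row i (V *m S) *m (row i V)^t*) 0 0 by [].
by rewrite !mxE; apply: eq_bigr => k _; rewrite !mxE.
Qed.

(** In an eigenbasis of [S - T], each eigenvalue is a difference of nonnegative diagonal entries of
    [S] and [T], so its modulus is at most their sum. *)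
Lemma trace_norm_le_split S T : S - T \is hermsymmx -> psd S -> psd T ->
  (trace_norm (S - T))%:C <= \tr S + \tr T.
Proof.
move=> Ah Sp Tp; rewrite trace_norm_hermitian//.
set V := spectralmx (S - T); have Vu : V \is unitarymx := spectral_unitarymx _.
have trV B : \tr B = \sum_i (V *m B *m V^t*) i i.
  rewrite -[RHS]/(\tr (V *m B *m V^t*)) mxtrace_mulC mulmxA -invmx_unitary//.
  by rewrite mulVmx ?unitarymx_unit// mul1mx.
rewrite !trV -big_split /=; apply: ler_sum => i _.
rewrite spectral_diagE// -/V mulmxBr mulmxBl.
rewrite mxE [X in _ + X]mxE (le_trans (ler_normB _ _))//.
by rewrite !ger0_norm ?psd_conj_diag_ge0.
Qed.

(* The pairing of A with the contraction 2Q - 1. *)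
Lemma trace_norm_ge_pairing A Q : A \is hermsymmx -> psd Q -> psd (1%:M - Q) ->
  2 * \tr (Q *m A) - \tr A <= (trace_norm A)%:C.
Proof.
move=> Ah Qp Qp'; rewrite trace_norm_hermitian//.
set V := spectralmx A; have Vu : V \is unitarymx := spectral_unitarymx _.
set d := spectral_diag A.
have trV B : \tr (B *m A) = \sum_i (V *m B *m V^t*) i i * d 0 i.
  rewrite {1}(spectral_decomposition _ Ah) -/V -/d !mulmxA mxtrace_mulC !mulmxA.
  by apply: eq_bigr => i _; rewrite mul_mx_diag mxE.
rewrite -{2}[A]mul1mx !trV mulr_sumr -sumrB; apply: ler_sum => i _.
have := psd_conj_diag_ge0 _ _ V i Qp; have := psd_conj_diag_ge0 _ _ V i Qp'.
rewrite mulmxBr mulmxBl mulmx1 (unitarymxP Vu).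
rewrite [X in 0 <= X -> _](_ : _ = 1 - (V *m Q *m V^t*) i i); last first.
  by rewrite mxE [_%:M i i]mxE eqxx mulr1n [X in _ + X]mxE.
rewrite [_%:M i i]mxE eqxx mulr1n.
set q := (V *m Q *m V^t*) i i => q1 q0.
(* As [0 <= q <= 1], the moduli of the two terms add up to exactly [|d 0 i|]. *)
have -> : 2 * (q * d 0 i) - 1 * d 0 i = q * d 0 i - (1 - q) * d 0 i by ring.
apply: le_trans (_ : `|q * d 0 i| + `|(1 - q) * d 0 i| <= _); last first.
  by rewrite !normrM (ger0_norm q0) (ger0_norm q1) -mulrDl addrC subrK mul1r.
apply: le_trans (ler_normB _ _); apply: real_ler_norm.
by rewrite realB ?realM ?(ger0_real q0) ?(ger0_real q1) ?spectral_diag_real.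
Qed.

Lemma psd_gram m (B : 'M[R[i]]_(n, m)) : psd (B *m B^t*).
Proof.
split=> [|v]; first by apply/hermsymmxP; rewrite adjM trmxCK.
have -> : v^t* *m (B *m B^t*) *m v = (B^t* *m v)^t* *m (B^t* *m v).
  by rewrite adjM trmxCK !mulmxA.
rewrite mxE sumr_ge0// => k _; rewrite !mxE mulrC; exact: mul_conjC_ge0.
Qed.

Lemma psd_projection Q : Q \is hermsymmx -> Q *m Q = Q -> psd Q.
Proof. by move=> /hermsymmxP Qh QQ; rewrite -QQ -{2}Qh; exact: psd_gram. Qed.

Lemma psdZ c S : 0 <= c -> psd S -> psd (c *: S).
Proof.
move=> c0 [/hermsymmxP Sh Sp]; split.
  by apply/hermsymmxP; rewrite adjZ ?Sh.
by move=> v; rewrite -scalemxAr -scalemxAl mxE mulr_ge0.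
Qed.

(** The upper bound is the splitting [S - 0]; the lower bound is the pairing with [Q = 1]. *)
Lemma trace_norm_psd S : psd S -> (trace_norm S)%:C = \tr S.
Proof.
move=> Sp; have [Sh _] := Sp.
have psd0 : psd (0 : 'M[R[i]]_n) by have := psd_gram 0 0; rewrite mul0mx.
have psd1 : psd (1%:M : 'M[R[i]]_n).
  by apply: psd_projection; rewrite ?mulmx1// hermitian1mx_subproof.
apply/eqP; rewrite eq_le; apply/andP; split.
  by have := trace_norm_le_split S 0; rewrite subr0 mxtrace0 addr0; apply.
have := trace_norm_ge_pairing S 1%:M Sh psd1.
by rewrite subrr mul1mx mulr_natl mulr2n addrK; apply.
Qed.

Lemma D_coh_eq1 (rho : 'M[R[i]]_n) : mixed_state rho ->
  D_coh rho = 1 <-> forall X, C_coh X -> 1 <= trace_norm (rho - X).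
Proof.
case=> rhop tr1; have n1 : trace_norm rho = 1.
  by apply: complexI; rewrite trace_norm_psd.
rewrite /D_coh /set_min; set D := image _ _.
have D1 : D 1.
  exists 0; last by rewrite subr0.
  split; first by have := psd_gram 0 0; rewrite mul0mx.
  by apply/is_diag_mxP => i j _; rewrite mxE.
split=> [|lb1].
  (* The default value of [set_min] is 0, so the value 1 must be a genuine minimum. *)
  case: xgetP => [x _ [_ lbx] x1 X hX|_ /esym/eqP]; last by rewrite oner_eq0.
  by rewrite -x1; apply: lbx; exists X.
have lbD : lbound D 1 by move=> _ [X hX <-]; exact: lb1.
apply: xget_unique => [|y [Dy lby]]; first by split.
by apply/eqP; rewrite eq_le lby// lbD.
Qed.

(** * Rank-one perturbations that lower the trace norm *)

Lemma quad_rank1 m (u v : 'cV[R[i]]_m) :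
  (v^t* *m (u *m u^t*) *m v) 0 0 = `|(u^t* *m v) 0 0| ^+ 2.
Proof.
have -> : v^t* *m (u *m u^t*) *m v = (u^t* *m v)^t* *m (u^t* *m v).
  by rewrite adjM trmxCK !mulmxA.
by rewrite [LHS]mxE big_ord1 2!mxE normCKC.
Qed.

Lemma trace_rank1 m (u : 'cV[R[i]]_m) : \tr (u *m u^t*) = (u^t* *m u) 0 0.
Proof. by rewrite mxtrace_mulC /mxtrace big_ord1. Qed.

(* Expand the form at v - t <u, v> w, with u = S w. *)
Lemma psd_ge_range_rank1 S (w : 'cV[R[i]]_n) : psd S ->
  exists2 t : R[i], 0 < t & forall v,
    t * `|((S *m w)^t* *m v) 0 0| ^+ 2 <= (v^t* *m S *m v) 0 0.
Proof.
case=> /hermsymmxP Sh Sp; pose q := (w^t* *m S *m w) 0 0.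
have q0 : 0 <= q := Sp w.
have q1 : 0 < 1 + q by rewrite ltr_wpDr.
(* Taking [1 + q] rather than [q] covers [q = 0] and gives [1 - t * q = t], so the remainder of the
   expansion is nonnegative. *)
pose t := (1 + q)^-1; have t0 : 0 < t by rewrite invr_gt0.
exists t => // v; rewrite adjM Sh; set y := (_ *m _ *m v) 0 0.
have yE : (v^t* *m S *m w) 0 0 = Num.conj y.
  suff -> : v^t* *m S *m w = (w^t* *m S *m v)^t* by rewrite 2!mxE.
  by rewrite !adjM trmxCK Sh mulmxA.
have := Sp (v - (t * y) *: w).
rewrite adjB [in X in _ - X]linearZ map_mxZ /=.
rewrite !(mulmxBl, mulmxBr) -!(scalemxAl, scalemxAr).
have entry (K L M N : 'M[R[i]]_1) (a b : R[i]) :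
    (K - a *: L - (b *: M - a *: (b *: N))) 0 0
    = K 0 0 - a * L 0 0 - (b * M 0 0 - a * (b * N 0 0)) by rewrite !mxE.
rewrite entry -/y -/q yE rmorphM /= (conj_Creal (gtr0_real t0)) normCK.
set z := Num.conj y; set a := (v^t* *m S *m v) 0 0 => ge0.
have tq : 1 - t * q = t by rewrite /t; field; rewrite gt_eqF.
have zy0 : 0 <= t * (t * (y * z))
  by rewrite 2?mulr_ge0 ?mul_conjC_ge0 ?(ltW t0).
rewrite -subr_ge0.
have -> : a - t * (y * z) = (a - t * z * y - (t * y * z - t * z * (t * y * q)))
    + (1 - t * q) * (t * (y * z)) by ring.
by rewrite addr_ge0// tq.
Qed.

(** The right side exceeds the left by [|x - e * y|^2 / e]. *)
Lemma norm_sqrD_le (e x y : R[i]) : 0 < e ->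
  `|x + y| ^+ 2 <= (1 + e^-1) * `|x| ^+ 2 + (1 + e) * `|y| ^+ 2.
Proof.
move=> e0; rewrite -subr_ge0 !normCK.
suff -> : (1 + e^-1) * (x * Num.conj x) + (1 + e) * (y * Num.conj y)
    - (x + y) * Num.conj (x + y) = e^-1 * `|x - e * y| ^+ 2.
  by rewrite mulr_ge0 ?exprn_ge0// invr_ge0 ltW.
rewrite normCK rmorphD rmorphB rmorphM /= (conj_Creal (gtr0_real e0)).
by field; rewrite gt_eqF.
Qed.

Lemma compl_idempotent P : P *m P = P -> (1%:M - P) *m (1%:M - P) = 1%:M - P.
Proof. by move=> PP; rewrite mulmxBr mulmx1 mulmxBl mul1mx PP subrr subr0. Qed.

(* With p = P_jj > 1/2, the state is improved by subtracting a small multiple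
   x of E_jj = e e^*.  Writing e = a + b with a = P e in the range of rho, AM-GM
   gives e e^* <= (1 + 1/eps) a a^* + (1 + eps) b b^*, where the first term is
   absorbed by rho and the second has trace (1 + eps)(1 - p) < 1/2. *)
Lemma trace_norm_decrease (rho P : 'M[R[i]]_n) j :
  mixed_state rho -> P \is hermsymmx -> P *m P = P -> (P^T <= rho^T)%MS ->
  1 / 2 < P j j -> exists2 X, C_coh X & trace_norm (rho - X) < 1.
Proof.
move=> [rhop tr1] /hermsymmxP Ph PP /submxP[D PD] p2.
have [/hermsymmxP rhoh _] := rhop.
pose e : 'cV[R[i]]_n := delta_mx j 0; pose p := P j j.
(* This makes [D^T *m e] an explicit preimage of [a] under [rho]. *)
have Prho : P = rho *m D^T by rewrite -[P]trmxK PD trmx_mul trmxK.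
pose a := P *m e; pose b := e - a.
have eE m (M : 'M[R[i]]_(n, m)) k : (e^t* *m M) 0 k = M j k.
  by rewrite trmx_delta map_delta_mx -rowE mxE.
have bb : (b^t* *m b) 0 0 = 1 - p.
  have -> : b^t* *m b = e^t* *m (1%:M - P) *m e.
    have -> : b = (1%:M - P) *m e by rewrite mulmxBl mul1mx.
    rewrite adjM adjB Ph trmx1 map_mx1 !mulmxA -(mulmxA (e^t*)).
    by rewrite compl_idempotent.
  by rewrite -mulmxA eE -colE !mxE eqxx.
have [t t0 rho_ge] := psd_ge_range_rank1 rho (D^T *m e) rhop.
rewrite mulmxA -Prho -/a in rho_ge.
pose eps := p - 1 / 2; have eps0 : 0 < eps by rewrite subr_gt0.
(* Chosen so that the coefficient [x * (1 + eps^-1)] of [a a^*] is exactly the [t] that [rho] can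
   absorb. *)
pose x := t * eps / (1 + eps).
have eps1 : 0 < 1 + eps by rewrite addr_gt0.
have x0 : 0 < x by rewrite divr_gt0 ?mulr_gt0.
have xeps : x * (1 + eps^-1) = t.
  by rewrite /x; field; rewrite !gt_eqF.
pose X := x *: (e *m e^t*); pose T := (x * (1 + eps)) *: (b *m b^t*).
have Xp : psd X by apply: psdZ (ltW x0) (psd_gram _ _).
have Tp : psd T by apply: psdZ (psd_gram _ _); rewrite mulr_ge0// ltW.
have [/hermsymmxP Xh _] := Xp; have [/hermsymmxP Th _] := Tp.
have Sp : psd (rho - X + T).
  split=> [|v]; first by apply/hermsymmxP; rewrite adjD adjB rhoh Xh Th.
  rewrite mulmxDr mulmxBr mulmxDl mulmxBl -!scalemxAr -!scalemxAl.
  have entry (K L M : 'M[R[i]]_1) (c d : R[i]) :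
    (K - c *: L + d *: M) 0 0 = K 0 0 - c * L 0 0 + d * M 0 0 by rewrite !mxE.
  rewrite entry !quad_rank1 addrAC subr_ge0.
  have -> : e^t* *m v = a^t* *m v + b^t* *m v.
    by rewrite -mulmxDl -adjD /b addrC subrK.
  rewrite [X in `|X|]mxE.
  apply: le_trans (ler_wpM2l (ltW x0) (norm_sqrD_le _ _ _ eps0)) _.
  by rewrite mulrDr ![x * (_ * _)]mulrA xeps lerD2r rho_ge.
exists X.
  split=> //; apply/is_diag_mxP => k l kl.
  rewrite /X trmx_delta map_delta_mx mul_delta_mx !mxE.
  case: eqP => [kj|]; case: eqP => [lj|]; rewrite ?mulr0//.
  by rewrite kj lj eqxx in kl.
(* Adding [T] restores positivity, at the cost of counting [\tr T] twice in the bound. *)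
have XE : rho - X = (rho - X + T) - T by rewrite addrK.
rewrite -(ltcR (trace_norm _)) XE.
apply: le_lt_trans (trace_norm_le_split _ _ _ Sp Tp) _.
  by apply/hermsymmxP; rewrite -XE adjB rhoh Xh.
rewrite mxtraceD raddfB /= !mxtraceZ !trace_rank1 tr1 bb eE mxE eqxx.
rewrite -subr_gt0.
(* The gain is [x * (1 - 2 * (1 + eps) * (1 - p))], which factors because [eps = p - 1 / 2]. *)
have -> : 1%:C - (1 - x * 1 + x * (1 + eps) * (1 - p) + x * (1 + eps) * (1 - p))
   = 2 * x * p * eps.
  by rewrite /eps; field.
have p0 : 0 < p by apply: lt_trans p2; rewrite divr_gt0.
exact: mulr_gt0 (mulr_gt0 (mulr_gt0 (ltr0Sn _ 1) x0) p0) eps0.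
Qed.

End TraceNorm.

Theorem theorem8 (R : realType) (n : nat) (rho P : 'M[R[i]]_n)
    (hrho : mixed_state rho) (hP : orthogonal_projection_onto_range rho P) :
  D_coh rho = 1 <-> (forall j : 'I_n, P j j <= 1 / 2).
Proof.
have [Ph PP PR] := hP; have [[/hermsymmxP rhoh _] tr1] := hrho.
have Pp : psd P := psd_projection _ Ph PP.
have P_real j : P j j \is Num.real.
  by apply/CrealP; rewrite -{2}(hermsymmxP Ph) !mxE.
rewrite D_coh_eq1//; split=> [ge1 j|P2 X [Xp Xd]].
  (* The order on [R[i]] is partial; the case split needs both sides real. *)
  have half_real : (1 / 2 : R[i]) \is Num.real by rewrite ger0_real ?divr_ge0.
  have [//|p2] := real_leP (P_real j) half_real.
  have [|X hX] := trace_norm_decrease _ _ j hrho Ph PP _ p2.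
    by rewrite PR.
  by rewrite ltNge ge1.
have [/hermsymmxP Xh _] := Xp.
have P'p : psd (1%:M - P).
  apply: psd_projection.
    by apply/hermsymmxP; rewrite adjB (hermsymmxP Ph) trmx1 map_mx1.
  exact: compl_idempotent.
have Prho : P *m rho = rho.
  have /submxP[D rhoD] : (rho^T <= P^T)%MS by rewrite PR.
  have -> : rho = P *m D^T by rewrite -[rho]trmxK rhoD trmx_mul trmxK.
  by rewrite mulmxA PP.
(* Since [P] fixes [rho], the pairing equals [1 + \tr X - 2 * \tr (P *m X)]. *)
rewrite -lecR; apply: le_trans (trace_norm_ge_pairing _ _ _ Pp P'p); last first.
  by apply/hermsymmxP; rewrite adjB rhoh Xh.
rewrite mulmxBr Prho !(raddfB (@mxtrace _ n)) /= tr1.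
(* As [X] is diagonal, only the diagonal of [P] enters, and the hypothesis yields
   [\tr (P *m X) <= \tr X / 2]. *)
have -> : \tr (P *m X) = \sum_i P i i * X i i.
  apply: eq_bigr => i _; rewrite mxE (bigD1 i)//= big1 ?addr0// => k ki.
  by rewrite (is_diag_mxP Xd) ?mulr0.
have XP i : P i i * X i i <= 1 / 2 * X i i.
  apply: ler_wpM2r (P2 i).
  have := psd_conj_diag_ge0 _ _ 1%:M i Xp.
  by rewrite mul1mx trmx1 map_mx1 mulmx1.
have : \sum_i P i i * X i i <= 1 / 2 * \tr X.
  by rewrite mulr_sumr; apply: ler_sum => i _; exact: XP.
move: (\sum_i _) (\tr X) => s u su.
rewrite -subr_ge0.
have -> : 2 * (1 - s) - (1 - u) - 1%:C = 2 * (1 / 2 * u - s) by field.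
by rewrite mulr_ge0 ?subr_ge0.
Qed.
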